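(* Let $x_1,\dots,x_n\in\mathbb{R}^d$ and $x'_1,\dots,x'_m\in\mathbb{R}^d$ be the two input sequences of an attention head with matrices $W_K,W_Q\in\mathbb{R}^{d\times d_K}$, with logits $q_{ij}=\frac{1}{\sqrt{d_K}}x_i^\top W_KW_Q^\top x'_j$, softmax weights $p_{ij}=\exp(q_{ij})/\sum_{i'}\exp(q_{i'j})$ and outputs $y_j=\sum_i x_i p_{ij}\in\mathbb{R}^d$. Let $f$ be a real-valued function of $(y_1,\dots,y_m)$, differentiable at the outputs under consideration and regarded, through the attention head, as a function of $(x_i)_i$ and $(x'_j)_j$. Assume that at the given inputs $\mathbb{E}_j[q_{:j}]=0$ and $\mathbb{E}_j[x]=0$ for every $j\in\{1,\dots,m\}$. Then the Gradient$\times$Input relevances satisfy $$\sum_{i=1}^n \mathcal{R}(x_i)+\sum_{j=1}^m\mathcal{R}(x'_j)=\sum_{j=1}^m\mathcal{R}(y_j)+2\sum_{j=1}^m \mathrm{Cov}_j(q_{:j},x)^\top\frac{\partial f}{\partial y_j}.$$ In particular, conservation, i.e. the equality $\sum_i \mathcal{R}(x_i)+\sum_j\mathcal{R}(x'_j)=\sum_j\mathcal{R}(y_j)$, fails whenever the term $2\sum_j \mathrm{Cov}_j(q_{:j},x)^\top\frac{\partial f}{\partial y_j}$ is non-zero.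
   Context: Indices: $i$ ranges over $1,\dots,n$ (first sequence) and $j$ over $1,\dots,m$ (second sequence and outputs); $d$ and $d_K$ are positive integers. The sequences $(x_i)_i$ and $(x'_j)_j$ are treated as separate (independent) inputs when differentiating; $f$ depends on them only through the outputs $y_1,\dots,y_m$, and each $y_j$ depends on the $x_i$ both explicitly and through the weights $p_{ij}$. For each $j$, $p_j=(p_{ij})_i$ is a probability distribution on $\{1,\dots,n\}$. $\mathbb{E}_j[\cdot]$ and $\mathrm{Cov}_j(\cdot,\cdot)$ denote expectation and covariance under $p_j$: $\mathbb{E}_j[x]=\sum_i p_{ij}x_i\in\mathbb{R}^d$, $\mathbb{E}_j[q_{:j}]=\sum_i p_{ij}q_{ij}\in\mathbb{R}$, and $\mathrm{Cov}_j(q_{:j},x)=\sum_i p_{ij}(q_{ij}-\mathbb{E}_j[q_{:j}])(x_i-\mathbb{E}_j[x])\in\mathbb{R}^d$. Gradient$\times$Input relevances: $\mathcal{R}(x_i)=x_i^\top\frac{\partial f}{\partial x_i}$, $\mathcal{R}(x'_j)={x'_j}^\top\frac{\partial f}{\partial x'_j}$, $\mathcal{R}(y_j)=y_j^\top\frac{\partial f}{\partial y_j}$, where the derivatives with respect to $x_i$ and $x'_j$ are the total gradients of $f$ composed with the attention head, and $\frac{\partial f}{\partial y_j}\in\mathbb{R}^d$ is the gradient of $f$ with respect to the output $y_j$. *)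

(* Defs.v *)
From mathcomp Require Import all_boot all_order all_algebra.
From mathcomp Require Import all_classical all_reals all_analysis.
Import Order.TTheory GRing.Theory Num.Theory.
Import numFieldNormedType.Exports.

Set Implicit Arguments.
Unset Strict Implicit.
Unset Printing Implicit Defensive.

Local Open Scope ring_scope.

(* A sequence of k vectors of R^d is a matrix 'M[R]_(d, k) whose j-th column
   is the j-th vector. *)

Definition dotp (R : realType) (d : nat) (u v : 'cV[R]_d) : R :=
  (u^T *m v) 0 0.

(* Column j is the gradient of f with respect to the j-th vector of Z. *)
Definition gradient (R : realType) (d k : nat) (f : 'M[R]_(d, k) -> R)
    (Z : 'M[R]_(d, k)) : 'M[R]_(d, k) :=
  \matrix_(a < d, j < k) 'D_(delta_mx a j) f Z.

(* Gradient x Input relevance of the j-th vector of Z. *)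
Definition relevance (R : realType) (d k : nat) (f : 'M[R]_(d, k) -> R)
    (Z : 'M[R]_(d, k)) (j : 'I_k) : R :=
  dotp (col j Z) (col j (gradient f Z)).

Definition logit (R : realType) (d dK n m : nat) (WK WQ : 'M[R]_(d, dK))
    (X : 'M[R]_(d, n)) (X' : 'M[R]_(d, m)) (i : 'I_n) (j : 'I_m) : R :=
  (Num.sqrt dK%:R)^-1 * ((col i X)^T *m WK *m WQ^T *m col j X') 0 0.

Definition softmax (R : realType) (n : nat) (q : 'I_n -> R) (i : 'I_n) : R :=
  expR (q i) / \sum_(i' < n) expR (q i').

Definition weight (R : realType) (d dK n m : nat) (WK WQ : 'M[R]_(d, dK))
    (X : 'M[R]_(d, n)) (X' : 'M[R]_(d, m)) (i : 'I_n) (j : 'I_m) : R :=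
  softmax (fun i' => logit WK WQ X X' i' j) i.

(* Column j is y_j = \sum_i p_ij x_i. *)
Definition attention (R : realType) (d dK n m : nat) (WK WQ : 'M[R]_(d, dK))
    (X : 'M[R]_(d, n)) (X' : 'M[R]_(d, m)) : 'M[R]_(d, m) :=
  \matrix_(a < d, j < m) \sum_(i < n) X a i * weight WK WQ X X' i j.

Definition expect (R : realType) (n : nat) (p q : 'I_n -> R) : R :=
  \sum_(i < n) p i * q i.

Definition expectv (R : realType) (d n : nat) (p : 'I_n -> R)
    (x : 'I_n -> 'cV[R]_d) : 'cV[R]_d :=
  \sum_(i < n) p i *: x i.

Definition cov (R : realType) (d n : nat) (p q : 'I_n -> R)
    (x : 'I_n -> 'cV[R]_d) : 'cV[R]_d :=
  \sum_(i < n) (p i * (q i - expect p q)) *: (x i - expectv p x).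

(* Main.v *)
From HB Require Import structures.
Require Import Defs.
From mathcomp Require Import all_boot all_order all_algebra.
From mathcomp Require Import all_classical all_reals all_analysis.
From mathcomp Require Import ring.
Import Order.TTheory GRing.Theory Num.Theory.
Import numFieldNormedType.Exports.
Local Open Scope ring_scope.

Set Implicit Arguments.
Unset Strict Implicit.

(* Contracting a gradient with the input is the directional derivative along
   the input itself.  Each logit is linear in X and in X', hence along these
   directions it varies at rate q_ij; so, once E_j[q] = 0 is used, p_ij varies
   at rate p_ij q_ij.  The differential of the head is then Y + C along X and C
   along X', where column j of C is Cov_j(q, x).  Moreover Y = 0, since y_j is
   E_j[x]. *)

Lemma is_diff_fsum (R : realType) (V W : normedModType R) (k : nat)
    (f df : 'I_k -> V -> W) (x : V) :
  (forall i, is_diff x (f i) (df i)) ->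
  is_diff x (fun v => \sum_(i < k) f i v) (fun u => \sum_(i < k) df i u).
Proof.
move=> fx; rewrite -!fct_sumE.
elim/big_ind2: _ => [|? ? ? ? ? ?|i _]; first exact: is_diff_cst;
  [exact: is_diffD | exact: fx].
Qed.

Lemma is_diff_scalel_comp (R : realType) (V W : normedModType R)
    (f df : V -> R) (w : W) (x : V) :
  is_diff x f df -> is_diff x (fun v => f v *: w) (fun u => df u *: w).
Proof.
by move=> fx; apply: (@is_diff_comp _ _ _ _ f df ( *:%R ^~ w) ( *:%R ^~ w)).
Qed.

(** Expanding in the basis [delta_mx i j] turns a matrix-valued map into a finite sum of scalar maps
    times fixed matrices, so entrywise differentials suffice. *)
Lemma is_diff_mx (R : realType) (V : normedModType R) (k l : nat)
    (M dM : V -> 'M[R]_(k, l)) (x : V) :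
  (forall i j, is_diff x (fun v => M v i j) (fun u => dM u i j)) ->
  is_diff x M dM.
Proof.
move=> Mx.
have E (N : V -> 'M[R]_(k, l)) :
    N = fun v => \sum_i \sum_j N v i j *: delta_mx i j.
  by apply/funext => v; rewrite -matrix_sum_delta.
rewrite (E M) (E dM).
by do 2![apply: is_diff_fsum => ?]; exact: is_diff_scalel_comp.
Qed.

(** In finite dimension linearity already gives continuity: [g] is a finite combination of
    coordinate maps, each continuous and hence its own differential. *)
Lemma is_diff_scalar_mx (R : realType) (k l : nat) (g : 'M[R]_(k, l) -> R)
    (M : 'M[R]_(k, l)) : scalar g -> is_diff M g g.
Proof.
move=> g_lin.
pose gL : {scalar 'M[R]_(k, l)} :=
  HB.pack g (GRing.isLinear.Build _ _ _ _ _ g_lin).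
have -> : g = fun N => \sum_i \sum_j N i j *: g (delta_mx i j).
  apply/funext => N; rewrite -[g]/(gL : _ -> _) [in LHS](matrix_sum_delta N).
  rewrite linear_sum; apply: eq_bigr => i _; rewrite linear_sum.
  by apply: eq_bigr => j _; rewrite linearZ.
apply: is_diff_fsum => i; apply: is_diff_fsum => j; apply: is_diff_scalel_comp.
have c_lin : linear (fun N : 'M[R]_(k, l) => N i j : R).
  by move=> a A B; rewrite !mxE.
pose cL : {linear 'M[R]_(k, l) -> R} :=
  HB.pack (fun N : 'M[R]_(k, l) => N i j : R)
    (GRing.isLinear.Build _ _ _ _ _ c_lin).
apply: DiffDef; first exact: differentiable_coord.
rewrite -[fun N => _]/(cL : _ -> _); exact/diff_lin/coord_continuous.
Qed.

Lemma is_diff_expR (R : realType) (V : normedModType R)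
    (f df : V -> R) (x : V) :
  is_diff x f df ->
  is_diff x (fun v => expR (f v)) (fun u => expR (f x) * df u).
Proof.
move=> fx; apply: (@is_diff_comp _ _ _ _ f df expR ( *%R (expR (f x)))).
apply: DiffDef; first exact/derivable1_diffP/derivable_expR.
apply/funext => h; rewrite deriv1E; last exact: derivable_expR.
by rewrite derive1E derive_val mulrC.
Qed.

Lemma is_diff_inv (R : realType) (V : normedModType R) (f df : V -> R) (x : V) :
  f x != 0 -> is_diff x f df ->
  is_diff x (fun v => (f v)^-1) (fun u => - (f x) ^- 2 * df u).
Proof.
move=> fx0 fx; apply: DiffDef; first exact: differentiableV.
by apply/funext => u; rewrite diffV //= [in LHS]diff_val.
Qed.

Lemma is_diff_softmax (R : realType) (V : normedModType R) (n : nat)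
    (q dq : 'I_n -> V -> R) (x : V) (i : 'I_n) :
  (forall i', is_diff x (q i') (dq i')) ->
  let p := softmax (q ^~ x) in
  is_diff x (fun v => softmax (q ^~ v) i)
    (fun u => p i * (dq i u - expect p (dq ^~ u))).
Proof.
move=> qx p.
(* The index [i] itself supplies a positive term, so the normalizer cannot vanish. *)
have S0 : \sum_i' expR (q i' x) != 0.
  apply: lt0r_neq0; rewrite (bigD1 i) //= ltr_pwDl ?expR_gt0 //.
  by apply: sumr_ge0 => ? _; exact: expR_ge0.
have ex i' := is_diff_expR (qx i').
have pdiff := is_diffM (ex i)
  (is_diff_inv (f := fun v => \sum_i' expR (q i' v)) S0 (is_diff_fsum ex)).
apply: (is_diff_eq pdiff); apply/funext => u.
rewrite /= /p /expect /softmax !fctE /GRing.scale /=.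
set S := \sum_i' expR (q i' x) in S0 *; set T := \sum_i' _ * dq i' u.
(* [T] is the differential of the normalizer [S], so the mean of [dq] under the softmax is its
   logarithmic derivative; what remains is the quotient rule. *)
have -> : \sum_i' expR (q i' x) / S * dq i' u = T / S.
  by rewrite mulr_suml; apply: eq_bigr => i' _; rewrite mulrAC.
by field.
Qed.

(** The direction [W] is independent of the base point [Z]: relevances use [W = Z], while the
    covariance term pairs the gradient at the output with another matrix. *)
Lemma sum_dotp_gradient (R : realType) (d k : nat) (f : 'M[R]_(d, k) -> R)
    (Z W : 'M[R]_(d, k)) :
  differentiable f Z ->
  \sum_(j < k) dotp (col j W) (col j (gradient f Z)) = 'd f Z W.
Proof.
move=> fZ; rewrite [in RHS](matrix_sum_delta W) exchange_big linear_sum.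
apply: eq_bigr => j _; rewrite /dotp mxE linear_sum; apply: eq_bigr => a _.
by rewrite !mxE linearZ deriveE.
Qed.

Lemma sum_relevance_comp (R : realType) (d k d' k' : nat)
    (f : 'M[R]_(d, k) -> R) (g : 'M[R]_(d', k') -> 'M[R]_(d, k))
    (Z : 'M[R]_(d', k')) :
  differentiable g Z -> differentiable f (g Z) ->
  \sum_(j < k') relevance (fun W => f (g W)) Z j = 'd f (g Z) ('d g Z Z).
Proof.
move=> gZ fgZ.
have fg : differentiable (f \o g) Z by exact: differentiable_comp.
by rewrite /relevance (sum_dotp_gradient Z fg) diff_comp.
Qed.

(** Product rule on each term. Values and logits depend on an abstract parameter, so that one
    formula covers both inputs: values move with the first sequence and stay constant under the
    second. *)
Lemma is_diff_attention (R : realType) (V : normedModType R) (d n m : nat)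
    (X dX : V -> 'M[R]_(d, n)) (q dq : 'I_n -> 'I_m -> V -> R) (v : V) :
  is_diff v X dX ->
  (forall i j, is_diff v (q i j) (dq i j)) ->
  let p j := softmax (fun i => q i j v) in
  is_diff v
    (fun w => \matrix_(a < d, j < m)
       \sum_(i < n) X w a i * softmax (fun i' => q i' j w) i)
    (fun u => \matrix_(a < d, j < m)
       \sum_(i < n) p j i *
         (dX u a i + X v a i * (dq i j u - expect (p j) (fun i' => dq i' j u)))).
Proof.
move=> Xv qv p; apply: is_diff_mx => a j.
have Xc i : is_diff v (fun w => X w a i) (fun u => dX u a i).
  apply: (@is_diff_comp _ _ _ _ X dX (fun Z => Z a i) (fun Z => Z a i)).
  by apply: is_diff_scalar_mx => c A B; rewrite !mxE.
under [X in is_diff _ X _]funext do rewrite mxE.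
under [X in is_diff _ _ X]funext do rewrite mxE.
apply: is_diff_fsum => i.
have tdiff := is_diffM (Xc i) (is_diff_softmax i (qv ^~ j)).
apply: (is_diff_eq tdiff); apply/funext => u.
by rewrite /p /= !fctE /GRing.scale /=; ring.
Qed.

Lemma logit_scalarl (R : realType) (d dK n m : nat) (WK WQ : 'M[R]_(d, dK))
    (X' : 'M[R]_(d, m)) (i : 'I_n) (j : 'I_m) :
  scalar (fun X : 'M[R]_(d, n) => logit WK WQ X X' i j).
Proof.
by move=> c A B; rewrite /logit !linearP /= !mulmxDl -!scalemxAl !mxE; ring.
Qed.

Lemma logit_scalarr (R : realType) (d dK n m : nat) (WK WQ : 'M[R]_(d, dK))
    (X : 'M[R]_(d, n)) (i : 'I_n) (j : 'I_m) :
  scalar (fun X' : 'M[R]_(d, m) => logit WK WQ X X' i j).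
Proof.
by move=> c A B; rewrite /logit linearP /= !mulmxDr -!scalemxAr !mxE; ring.
Qed.

Unset Implicit Arguments.
Set Strict Implicit.

Theorem proposition3p1 (R : realType) (d dK n m : nat)
    (hd : (0 < d)%N) (hdK : (0 < dK)%N)
    (WK WQ : 'M[R]_(d, dK)) (X : 'M[R]_(d, n)) (X' : 'M[R]_(d, m))
    (f : 'M[R]_(d, m) -> R)
    (hf : differentiable f (attention WK WQ X X'))
    (hq : forall j : 'I_m,
      expect (fun i => weight WK WQ X X' i j)
             (fun i => logit WK WQ X X' i j) = 0)
    (hx : forall j : 'I_m,
      expectv (fun i => weight WK WQ X X' i j) (fun i => col i X) = 0) :
  let Y := attention WK WQ X X' in
  let total_input :=
    \sum_(i < n) relevance (fun Z => f (attention WK WQ Z X')) X i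
    + \sum_(j < m) relevance (fun Z' => f (attention WK WQ X Z')) X' j in
  let total_output := \sum_(j < m) relevance f Y j in
  let defect :=
    2 * \sum_(j < m)
      dotp (cov (fun i => weight WK WQ X X' i j)
                (fun i => logit WK WQ X X' i j)
                (fun i => col i X))
           (col j (gradient f Y)) in
  total_input = total_output + defect
  /\ (defect <> 0 -> total_input <> total_output).
Proof.
move=> Y total_input total_output defect.
pose C : 'M[R]_(d, m) := \matrix_(a < d, j < m)
  cov (weight WK WQ X X' ^~ j) (logit WK WQ X X' ^~ j) (fun i => col i X) a 0.
have Y0 : Y = 0.
  apply/matrixP => a j; move/matrixP/(_ a 0): (hx j).
  rewrite /expectv summxE !mxE => {2}<-.
  by apply: eq_bigr => i _; rewrite !mxE mulrC.
(* With both means zero, the covariance is the plain mixed moment. *)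
have CE (a : 'I_d) (j : 'I_m) : C a j =
    \sum_(i < n) weight WK WQ X X' i j * (X a i * logit WK WQ X X' i j).
  rewrite mxE /cov hq hx summxE; apply: eq_bigr => i _.
  by rewrite !subr0 !mxE; ring.
have /= dattX := is_diff_attention (is_diff_id X)
  (fun i j => is_diff_scalar_mx X (logit_scalarl WK WQ X' i j)).
have /= dattX' := is_diff_attention (is_diff_cst X X')
  (fun i j => is_diff_scalar_mx X' (logit_scalarr WK WQ X i j)).
have {}dattX : is_diff X (attention WK WQ ^~ X') _ := dattX.
have {}dattX' : is_diff X' (attention WK WQ X) _ := dattX'.
have EX : 'd (attention WK WQ ^~ X') X X = C.
  rewrite diff_val; apply/matrixP => a j; rewrite CE mxE.
  (* Moving the values along [X] itself contributes the output entry [Y a j]; it is inserted here as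
     a zero so that both sides match term by term. *)
  rewrite -[RHS]add0r -[X in _ = X + _](_ : Y a j = 0); last by rewrite Y0 mxE.
  rewrite mxE -big_split /=; apply: eq_bigr => i _.
  (* The logit, linear in the varied input, has itself as differential along that input, so the
     subtracted mean is the one that [hq] kills. *)
  by rewrite [expect _ _]hq /weight; ring.
have EX' : 'd (attention WK WQ X) X' X' = C.
  rewrite diff_val; apply/matrixP => a j; rewrite CE mxE; apply: eq_bigr => i _.
  have -> : (0 : 'M[R]_(d, m) -> 'M[R]_(d, n)) X' a i = 0 by rewrite mxE.
  by rewrite [expect _ _]hq /weight; ring.
(* Each of the two sequences contributes one copy of the same term, whence the factor 2. *)
have ti : total_input = 'd f Y C + 'd f Y C.
  rewrite /total_input.
  rewrite (sum_relevance_comp (g := attention WK WQ ^~ X')) // EX.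
  by rewrite (sum_relevance_comp (g := attention WK WQ X)) // EX'.
have to : total_output = 0.
  by rewrite /total_output /relevance sum_dotp_gradient // Y0 linear0.
have de : defect = 'd f Y C + 'd f Y C.
  rewrite /defect -mulr2n mulr_natl -sum_dotp_gradient //; congr (_ *+ 2).
  apply: eq_bigr => j _; congr dotp; apply/matrixP => a k.
  by rewrite !mxE ord1.
(* Since the total output is 0, total input and defect coincide, and the failure of conservation is
   immediate. *)
by rewrite ti to de add0r.
Qed.
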